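(* Let $\mu$ be a finite deficient topological measure on $X$, let $f\in C_b(X)$, and let $r$ and $l$ be the right and left measures determined by $\mu$ and $f$. Then $r=l$ if and only if $L_1(t)+R_1(t)=\mu(X)$ for almost every $t\in\mathbb{R}$ with respect to Lebesgue measure.
   Context: $X$ is a locally compact Hausdorff connected space; $\mathscr{O}(X),\mathscr{C}(X),\mathscr{K}(X)$ are the families of open, closed, compact subsets; $C_b(X)$ is the set of bounded real continuous functions. A deficient topological measure on $X$ is $\nu:\mathscr{C}(X)\cup\mathscr{O}(X)\to[0,\infty]$ such that: $\nu(C\sqcup K)=\nu(C)+\nu(K)$ for disjoint $C,K\in\mathscr{K}(X)$; $\nu(U)=\sup\{\nu(C): C\subseteq U, C\in\mathscr{K}(X)\}$ for open $U$; $\nu(F)=\inf\{\nu(U): F\subseteq U\in\mathscr{O}(X)\}$ for closed $F$. It is finite if $\nu(X)<\infty$. For finite $\mu$ and $f\in C_b(X)$: $L_1(t)=\mu(f^{-1}((-\infty,t)))$ and $R_1(t)=\mu(f^{-1}((t,\infty)))$, $t\in\mathbb{R}$. $L_1$ is non-decreasing and left-continuous, $R_1$ is non-increasing and right-continuous. The left measure $l$ is the Lebesgue–Stieltjes measure on $\mathbb{R}$ associated with $L_1$; the right measure $r$ is the Lebesgue–Stieltjes measure associated with $-R_1$. *)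

(* Defs.v *)
From HB Require Import structures.
From mathcomp Require Import all_boot all_order all_algebra.
From mathcomp Require Import all_classical all_reals all_analysis.
From mathcomp Require Import lra.

Set Implicit Arguments.
Unset Strict Implicit.
Unset Printing Implicit Defensive.

Import Order.TTheory GRing.Theory Num.Theory.
Import numFieldNormedType.Exports.

Local Open Scope classical_set_scope.
Local Open Scope ring_scope.

(* [nu] is a total function on [set X], but only its values on open and closed
   sets are constrained. The compact sets are among the closed sets only when
   [X] is Hausdorff, which is a hypothesis wherever it is needed. *)
Record is_deficient_topological_measure (X : topologicalType) (R : realType)
    (nu : set X -> \bar R) : Prop := {
  dtm_ge0 : forall A, open A \/ closed A -> (0 <= nu A)%E ;
  dtm_setU : forall C K, compact C -> compact K -> C `&` K = set0 ->
    nu (C `|` K) = (nu C + nu K)%E ;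
  dtm_inner : forall U, open U ->
    nu U = ereal_sup [set nu C | C in [set C | compact C /\ C `<=` U]] ;
  dtm_outer : forall F, closed F ->
    nu F = ereal_inf [set nu U | U in [set U | open U /\ F `<=` U]] }.

Record finite_deficient_topological_measure
    (X : topologicalType) (R : realType) := FiniteDTM {
  finite_dtm_fun :> set X -> \bar R ;
  finite_dtm_is_dtm : is_deficient_topological_measure finite_dtm_fun ;
  finite_dtm_lty : (finite_dtm_fun [set: X] < +oo)%E }.

Section distribution_functions.
Context {X : topologicalType} {R : realType}.
Variable mu : finite_deficient_topological_measure X R.

Lemma finite_dtm_le (A B : set X) : open A -> open B -> A `<=` B ->
  (mu A <= mu B)%E.
Proof.
move=> oA oB AB; have H := finite_dtm_is_dtm mu.
rewrite (dtm_inner H oA) (dtm_inner H oB).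
apply: ereal_sup_le => _ [C [cC CA] <-].
by exists C => //; split => //; exact: subset_trans AB.
Qed.

Lemma finite_dtm_fin_num (A : set X) : open A -> mu A \is a fin_num.
Proof.
move=> oA; have H := finite_dtm_is_dtm mu.
rewrite ge0_fin_numE; last by apply: (dtm_ge0 H); left.
by apply: le_lt_trans (finite_dtm_lty mu); apply: finite_dtm_le => //; exact: openT.
Qed.

(* [fine] loses nothing for a continuous [f], see [finite_dtm_fin_num]. *)
Definition L1 (f : X -> R) (t : R) : R := fine (mu (f @^-1` `]-oo, t[)).
Definition R1 (f : X -> R) (t : R) : R := fine (mu (f @^-1` `]t, +oo[)).

Lemma open_preimage_Nyo (f : continuousType X R) t : open (f @^-1` `]-oo, t[).
Proof.
by apply: open_comp => [x _|]; [exact: (@cts_fun _ _ f)|exact: interval_open].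
Qed.

Lemma open_preimage_oy (f : continuousType X R) t : open (f @^-1` `]t, +oo[).
Proof.
by apply: open_comp => [x _|]; [exact: (@cts_fun _ _ f)|exact: interval_open].
Qed.

Lemma L1_nondecreasing (f : continuousType X R) : nondecreasing (L1 f).
Proof.
move=> s t st; apply: fine_le; rewrite ?finite_dtm_fin_num//;
  try exact: open_preimage_Nyo.
apply: finite_dtm_le; try exact: open_preimage_Nyo.
by move=> x /=; rewrite !in_itv/= => /lt_le_trans; exact.
Qed.

Lemma R1_nonincreasing (f : continuousType X R) :
  {homo R1 f : s t / s <= t >-> t <= s}.
Proof.
move=> s t st; apply: fine_le; rewrite ?finite_dtm_fin_num//;
  try exact: open_preimage_oy.
apply: finite_dtm_le; try exact: open_preimage_oy.
by move=> x /=; rewrite !in_itv/= !andbT; exact: le_lt_trans.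
Qed.

Lemma L1_left_approx (f : continuousType X R) t e : 0 < e ->
  exists2 s, s < t & L1 f t - e < L1 f s.
Proof.
move=> e0; have H := finite_dtm_is_dtm mu.
have oN := open_preimage_Nyo f.
have : (mu (f @^-1` `]-oo, t[) - e%:E < mu (f @^-1` `]-oo, t[))%E.
  by rewrite lteBlDr// lteDl ?finite_dtm_fin_num// lte_fin.
rewrite [X in (_ < X)%E](dtm_inner H (oN t)) => /ereal_sup_gt[_ [C [cC CU] <-]] hC.
suff [s st Cs] : exists2 s, s < t & C `<=` f @^-1` `]-oo, s[.
  exists s => //; rewrite -lte_fin EFinB !fineK ?finite_dtm_fin_num//.
  apply: lt_le_trans hC _; rewrite (dtm_inner H (oN s)).
  by apply: ereal_sup_ubound; exists C.
have [->|/set0P C0] := eqVneq C set0.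
  by exists (t - 1); [rewrite ltrBlDr ltrDl|exact: sub0set].
have [|c cin cmax] := @compact_EVT_max _ _ f _ C0 cC.
  by apply: continuous_subspaceT => x; exact: (@cts_fun _ _ f).
have := CU c (set_mem cin); rewrite /= in_itv/= => fct.
exists ((f c + t) / 2); first by rewrite midf_lt.
move=> x Cx /=; rewrite in_itv/=.
by apply: le_lt_trans (cmax x (mem_set Cx)) _; rewrite midf_lt.
Qed.

Lemma R1_right_approx (f : continuousType X R) t e : 0 < e ->
  exists2 s, t < s & R1 f t - e < R1 f s.
Proof.
move=> e0; have H := finite_dtm_is_dtm mu.
have oN := open_preimage_oy f.
have : (mu (f @^-1` `]t, +oo[) - e%:E < mu (f @^-1` `]t, +oo[))%E.
  by rewrite lteBlDr// lteDl ?finite_dtm_fin_num// lte_fin.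
rewrite [X in (_ < X)%E](dtm_inner H (oN t)) => /ereal_sup_gt[_ [C [cC CU] <-]] hC.
suff [s st Cs] : exists2 s, t < s & C `<=` f @^-1` `]s, +oo[.
  exists s => //; rewrite -lte_fin EFinB !fineK ?finite_dtm_fin_num//.
  apply: lt_le_trans hC _; rewrite (dtm_inner H (oN s)).
  by apply: ereal_sup_ubound; exists C.
have [->|/set0P C0] := eqVneq C set0.
  by exists (t + 1); [rewrite ltrDl|exact: sub0set].
have [|c cin cmin] := @compact_EVT_min _ _ f _ C0 cC.
  by apply: continuous_subspaceT => x; exact: (@cts_fun _ _ f).
have := CU c (set_mem cin); rewrite /= in_itv/= andbT => fct.
exists ((t + f c) / 2); first by rewrite midf_lt.
move=> x Cx /=; rewrite in_itv/= andbT.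
by apply: lt_le_trans (cmin x (mem_set Cx)); rewrite midf_lt.
Qed.

Definition opp_R1 (f : X -> R) (t : R) : R := - R1 f t.

(* [lebesgue_stieltjes_measure] expects a right-continuous function, so the
   left-continuous [L1] enters through its right limits [t |-> L1 (t+)];
   [left_measure_itv_co] shows that this yields the usual normalization
   [a, b[ |-> L1 b - L1 a. *)
Definition L1_right_lim (f : X -> R) (t : R) : R := lim (L1 f s @[s --> t^'+]).

Lemma opp_R1_nondecreasing (f : continuousType X R) : nondecreasing (opp_R1 f).
Proof. by move=> s t st; rewrite /opp_R1 lerN2; exact: R1_nonincreasing. Qed.

Lemma opp_R1_right_continuous (f : continuousType X R) :
  right_continuous (opp_R1 f).
Proof.
move=> t; apply/cvgrPdist_lt => e e0.
have [s ts hs] := R1_right_approx f t e0.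
near=> u; rewrite /opp_R1 opprK addrC.
have tu : t < u by near: u; exact: nbhs_right_gt.
have us : u < s by near: u; exact: nbhs_right_lt.
rewrite ler0_norm; last by rewrite subr_le0 R1_nonincreasing// ltW.
rewrite opprB ltrBlDr -ltrBlDl.
by apply: lt_le_trans hs _; exact: R1_nonincreasing (ltW us).
Unshelve. all: by end_near. Qed.

Lemma is_cvg_L1_right (f : continuousType X R) t : cvg (L1 f s @[s --> t^'+]).
Proof.
apply: nondecreasing_at_right_is_cvgr.
  by near=> u => a b _ _; exact: L1_nondecreasing.
near=> u; exists (L1 f t) => _ [a + <-].
by rewrite /= in_itv/= => /andP[/ltW ta _]; exact: L1_nondecreasing.
Unshelve. all: by end_near. Qed.

Lemma L1_le_right_lim (f : continuousType X R) t : L1 f t <= L1_right_lim f t.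
Proof.
apply: limr_ge; first exact: is_cvg_L1_right.
by near=> u; apply: L1_nondecreasing; near: u; exact: nbhs_right_ge.
Unshelve. all: by end_near. Qed.

Lemma L1_right_lim_le (f : continuousType X R) s t : s < t ->
  L1_right_lim f s <= L1 f t.
Proof.
move=> st; apply: limr_le; first exact: is_cvg_L1_right.
by near=> u; apply: L1_nondecreasing; near: u; exact: nbhs_right_le.
Unshelve. all: by end_near. Qed.

Lemma L1_right_lim_nondecreasing (f : continuousType X R) :
  nondecreasing (L1_right_lim f).
Proof.
move=> s t; rewrite le_eqVlt => /predU1P[->//|st].
exact: le_trans (L1_right_lim_le f st) (L1_le_right_lim f t).
Qed.

Lemma L1_right_lim_right_continuous (f : continuousType X R) :
  right_continuous (L1_right_lim f).
Proof.
move=> t; apply/cvgrPdist_lt => e e0.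
have /cvgrPdist_lt/(_ e e0) h : L1 f s @[s --> t^'+] --> L1_right_lim f t.
  exact: is_cvg_L1_right.
near t^'+ => v.
have tv : t < v by near: v; exact: nbhs_right_gt.
have hv : `|L1_right_lim f t - L1 f v| < e by near: v; exact: h.
near=> u.
have tu : t < u by near: u; exact: nbhs_right_gt.
have uv : u < v by near: u; exact: nbhs_right_lt.
move: hv; rewrite !ler0_norm ?subr_le0 ?L1_right_lim_le//; last first.
  exact: L1_right_lim_nondecreasing (ltW tu).
by rewrite !opprB; apply: le_lt_trans; rewrite lerB// L1_right_lim_le.
Unshelve. all: by end_near. Qed.

HB.instance Definition _ (f : continuousType X R) := isCumulative.Build R _ R
  (opp_R1 f) (@opp_R1_nondecreasing f) (@opp_R1_right_continuous f).

HB.instance Definition _ (f : continuousType X R) := isCumulative.Build R _ R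
  (L1_right_lim f) (@L1_right_lim_nondecreasing f)
  (@L1_right_lim_right_continuous f).

Definition right_measure (f : continuousType X R) :
    {measure set (measurableTypeR R) -> \bar R} :=
  lebesgue_stieltjes_measure (opp_R1 f).

Definition left_measure (f : continuousType X R) :
    {measure set (measurableTypeR R) -> \bar R} :=
  lebesgue_stieltjes_measure (L1_right_lim f).

Lemma lebesgue_stieltjes_measure_itv_oc (F : cumulative R R) (a b : R) :
  a <= b -> lebesgue_stieltjes_measure F `]a, b]%classic = (F b - F a)%:E.
Proof.
move=> ab; rewrite /lebesgue_stieltjes_measure/= /measure_extension/=.
rewrite measurable_mu_extE/=; last exact: is_ocitv.
exact: wlength_itv_bnd.
Qed.

Lemma right_measure_itv_oc (f : continuousType X R) (a b : R) : a <= b ->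
  right_measure f `]a, b]%classic = (R1 f a - R1 f b)%:E.
Proof.
move=> ab; have -> : R1 f a - R1 f b = opp_R1 f b - opp_R1 f a.
  by rewrite /opp_R1 opprK addrC.
exact: lebesgue_stieltjes_measure_itv_oc.
Qed.

Lemma left_measure_set1 (f : continuousType X R) (a : R) :
  left_measure f [set a] = (L1_right_lim f a - L1 f a)%:E.
Proof.
set m := left_measure f.
have mE s t : s <= t -> m `]s, t]%classic = (L1_right_lim f t - L1_right_lim f s)%:E.
  exact: lebesgue_stieltjes_measure_itv_oc.
pose F k := `](a - k.+1%:R^-1)%R, a]%classic : set (measurableTypeR R).
have alt k : a - k.+1%:R^-1 < a by rewrite ltrBlDr ltrDl invr_gt0.
have FE : \bigcap_k F k = [set a] by rewrite [RHS]set1_bigcap_oc.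
have h1 : m \o F @ \oo --> m [set a].
  rewrite -FE; apply: nonincreasing_cvg_mu.
  - by rewrite mE ?ltry// ltW.
  - by move=> i; exact: (@measurable_itv R).
  - by rewrite FE; exact: (@measurable_set1 R).
  - move=> i j ij; apply/subsetPset => x; rewrite /F/= !in_itv/=.
    case/andP => + ->; rewrite andbT; apply: le_lt_trans.
    by rewrite lerB// lef_pV2 ?posrE// ler_nat.
apply: cvg_unique h1 _ => //.
rewrite (_ : m \o F = EFin \o
    (fun k => L1_right_lim f a - L1_right_lim f (a - k.+1%:R^-1))); last first.
  by apply/funext => k /=; rewrite mE// ltW.
apply: cvg_EFin; first by near=> k.
apply: cvgB; first exact: cvg_cst.
apply/cvgrPdist_lt => e e0.
have [s sa hs] := L1_left_approx f a e0.
have sa0 : 0 < a - s by rewrite subr_gt0.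
near=> k.
have sk : s < a - k.+1%:R^-1.
  rewrite ltrBrDl -ltrBrDr.
  by near: k; exact: (near_infty_natSinv_lt (PosNum sa0)).
rewrite ger0_norm ?subr_ge0 ?L1_right_lim_le//.
rewrite ltrBlDr -ltrBlDl (lt_le_trans hs)//.
apply: le_trans (L1_le_right_lim f _).
exact: L1_nondecreasing (ltW sk).
Unshelve. all: by end_near. Qed.

Lemma left_measure_itv_co (f : continuousType X R) (a b : R) : a <= b ->
  left_measure f `[a, b[%classic = (L1 f b - L1 f a)%:E.
Proof.
rewrite le_eqVlt => /predU1P[->|ab].
  by rewrite set_itvco0 subrr measure0.
set m := left_measure f.
have m_oc : m `]a, b]%classic = (L1_right_lim f b - L1_right_lim f a)%:E.
  exact: lebesgue_stieltjes_measure_itv_oc (ltW ab).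
have m_cc1 : m `[a, b]%classic = (m [set a] + m `]a, b]%classic)%E.
  rewrite -measureU.
  - by rewrite setU1itv// bnd_simp ltW.
  - exact: (@measurable_set1 R).
  - exact: (@measurable_itv R).
  - by apply/seteqP; split => // x [->]; rewrite /= in_itv/= ltxx.
have m_cc2 : m `[a, b]%classic = (m `[a, b[%classic + m [set b])%E.
  rewrite -measureU.
  - by rewrite setUitv1// bnd_simp ltW.
  - exact: (@measurable_itv R).
  - exact: (@measurable_set1 R).
  - by apply/seteqP; split => // x [+ xb]; rewrite xb /= in_itv/= ltxx andbF.
have : (m `[a, b[%classic + m [set b] = m [set a] + m `]a, b]%classic)%E.
  by rewrite -m_cc1 -m_cc2.
rewrite m_oc !left_measure_set1 => h.
have -> : m `[a, b[%classic =
    (m `[a, b[%classic + (L1_right_lim f b - L1 f b)%:E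
     - (L1_right_lim f b - L1 f b)%:E)%E by rewrite addeK.
by rewrite h; congr EFin; lra.
Qed.

End distribution_functions.

(* Main.v *)
Require Import Defs.
From mathcomp Require Import all_boot all_order all_algebra.
From mathcomp Require Import all_classical all_reals all_analysis.
From mathcomp Require Import lra.
Import Order.TTheory GRing.Theory Num.Theory.
Import numFieldNormedType.Exports.

Local Open Scope classical_set_scope.
Local Open Scope ring_scope.

(** Write [L1(t+)] for the right limit of [L1] at [t]. On a half-open interval
    [`]a, b]] the left measure has mass [L1(b+) - L1(a+)] and the right measure
    has mass [R1 a - R1 b]. Such intervals determine a Stieltjes measure, so the
    two measures agree if and only if [L1(t+) + R1 t] does not depend on [t]. As
    [f] is bounded, far to the left [L1] is [0] and [R1] is [mu X], hence the
    only possible constant is [mu X] ([right_left_measure_eqP]).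

    It remains to pass between the identity [L1(t+) + R1 t = mu X] for every [t]
    and the identity [L1 t + R1 t = mu X] for almost every [t]. The function
    [L1], being monotone, jumps only at countably many points, so [L1(t+)] and
    [L1 t] coincide almost everywhere ([ae_L1_right_limE]). Conversely,
    [L1(t+) + R1 t] is right-continuous in [t], and a right-continuous function
    that is almost everywhere constant is constant, since every interval
    [`]t, v[] has positive length ([right_continuous_ae_cst]). *)

(** If [g t] differed from [c] it would do so on some interval to the right
    of [t], which is not negligible. *)
Lemma right_continuous_ae_cst (R : realType) (g : R -> R) (c : R) :
  right_continuous g -> {ae @lebesgue_measure R, forall t : R, g t = c} ->
  forall t, g t = c.
Proof.
move=> gr aeg t; apply/eqP; rewrite -subr_eq0 -normr_le0 leNgt.
apply/negP => e0.
have /cvgrPdist_lt/(_ _ e0) := gr t.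
rewrite near_withinE => -[d /= d0 dP].
have gNc x : `]t, t + d[%classic x -> g x <> c.
  rewrite /= in_itv/= => /andP[tx xd] gxc.
  have /= := dP x; rewrite gxc ltxx => dPx; apply: (notF (dPx _ tx)).
  by rewrite distrC ger0_norm ?subr_ge0 1?ltW// ltrBlDl.
have [N [mN N0 sN]] := aeg.
have : (lebesgue_measure (`]t, (t + d)%R[%classic : set R) <= lebesgue_measure N)%E.
  apply: le_measure; first by rewrite inE; exact: (@measurable_itv R).
    by rewrite inE; exact: mN.
  by move=> x /gNc gx; apply: sN.
rewrite N0 lebesgue_measure_itv/= lte_fin ltrDl d0 -EFinB lee_fin.
by rewrite addrAC subrr add0r leNgt d0.
Qed.

Section left_right_measures.
Context {X : topologicalType} {R : realType}.
Variable mu : finite_deficient_topological_measure X R.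

(** [mu set0 = mu set0 + mu set0] by additivity, and [mu set0] is finite. *)
Lemma finite_dtm_set0 : mu set0 = 0%E.
Proof.
have := dtm_setU (finite_dtm_is_dtm mu) (@compact0 X) compact0 (setI0 set0).
have := finite_dtm_fin_num mu (@open0 X).
rewrite setU0; case: (mu set0) => //= r _ [rE].
by congr EFin; lra.
Qed.

(** Below the range of [f] the sublevel sets are empty and the superlevel sets
    are all of [X]; such points fix the constants of integration of both
    measures. *)
Lemma distribution_functions_left_of (f : continuousType X R) (t : R) :
    bounded_fun f ->
  exists s, [/\ s <= t, L1_right_lim mu f s = 0 &
                R1 mu f s = fine (mu [set: X])].
Proof.
move=> [M [_ Mf]].
(* [Mf] concerns the bounds strictly above [M]. *)
have {}Mf x : `|f x| <= M + 1 by apply: Mf => //; rewrite ltrDl.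
pose u := Num.min t (- (M + 1)) - 1.
have ut : u < t by rewrite /u ltrBlDr (@le_lt_trans _ _ t) ?ge_min ?lexx// ltrDl.
have uM : u < - (M + 1).
  rewrite /u ltrBlDr (@le_lt_trans _ _ (- (M + 1))) ?ge_min ?lexx ?orbT//.
  by rewrite ltrDl.
have uf x : u < f x.
  by have := Mf x; rewrite ler_norml => /andP[+ _]; exact: lt_le_trans.
have L1u : L1 mu f u = 0.
  rewrite /L1 (_ : f @^-1` _ = set0) ?finite_dtm_set0//.
  apply/seteqP; split => // x; rewrite /= in_itv/= => /lt_trans/(_ (uf x)).
  by rewrite ltxx.
(* [L1] vanishes at [u]; moving further left makes its right limit vanish. *)
exists (u - 1); split; first by lra.
- apply/eqP; rewrite eq_le; apply/andP; split.
    by rewrite -[leRHS]L1u; apply: L1_right_lim_le; lra.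
  apply: le_trans (L1_le_right_lim mu f _); apply: fine_ge0.
  by apply: (dtm_ge0 (finite_dtm_is_dtm mu)); left; exact: open_preimage_Nyo.
- rewrite /R1; congr (fine (mu _)); apply/seteqP; split => // x _.
  by rewrite /= in_itv/= andbT; apply: lt_trans (uf x); rewrite ltrBlDr ltrDl.
Qed.

(** The jump intervals [`]L1 t, L1(t+)[] of a monotone function are disjoint,
    and a disjoint family of nonempty open subsets of the line is countable. *)
Lemma countable_L1_jumps (f : continuousType X R) :
  countable [set t | L1 mu f t < L1_right_lim mu f t].
Proof.
(* Where there is no jump, the whole line is a dummy nonempty open set. *)
apply: (@separated_open_countable R R
  (fun t => if L1 mu f t < L1_right_lim mu f t
            then `]L1 mu f t, L1_right_lim mu f t[%classic else setT)) => [t|t|].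
- by case: ifP => _; [exact: interval_open|exact: openT].
- case: ifPn => [h|_]; last by exists 0.
  by exists ((L1 mu f t + L1_right_lim mu f t) / 2); rewrite /= in_itv/= !midf_lt.
- move=> s t /= hs ht; rewrite hs ht => -[x [/=]].
  rewrite !in_itv/= => /andP[sx xs] /andP[tx xt].
  have [st|ts|//] := ltgtP s t.
  + by have := L1_right_lim_le mu f st; lra.
  + by have := L1_right_lim_le mu f ts; lra.
Qed.

Lemma ae_L1_right_limE (f : continuousType X R) :
  {ae @lebesgue_measure R, forall t : R, L1_right_lim mu f t = L1 mu f t}.
Proof.
have cJ := countable_L1_jumps f.
exists [set t | L1 mu f t < L1_right_lim mu f t]; split.
- exact: (@countable_measurable _ (measurableTypeR R) _
    (@measurable_set1 R) cJ).
- exact: countable_lebesgue_measure0.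
- move=> t /= /eqP; rewrite eq_le L1_le_right_lim andbT.
  by rewrite -ltNge.
Qed.

(** For the direct implication, compare the masses of an interval [`]s, t]]
    with [s] to the left of the range of [f]. *)
Lemma right_left_measure_eqP (f : continuousType X R) : bounded_fun f ->
  (forall A : set R, measurable A -> right_measure mu f A = left_measure mu f A)
  <-> (forall t, L1_right_lim mu f t + R1 mu f t = fine (mu [set: X])).
Proof.
move=> bf.
have lE s t : s <= t -> left_measure mu f `]s, t]%classic =
    (L1_right_lim mu f t - L1_right_lim mu f s)%:E.
  exact: lebesgue_stieltjes_measure_itv_oc.
split=> [rl t|LR A mA].
  have [s [st Ls Rs]] := distribution_functions_left_of f t bf.
  have := rl `]s, t]%classic (measurable_itv _).
  by rewrite right_measure_itv_oc// lE// Ls Rs => -[]; lra.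
apply: lebesgue_stieltjes_measure_unique => // _ [[a b] _ <-]/=.
have [ab|ba] := leP a b; last first.
  rewrite set_itv_ge -?leNgt ?bnd_simp 1?ltW//.
  exact: etrans (measure0 (right_measure mu f))
                (esym (measure0 (left_measure mu f))).
rewrite [LHS](right_measure_itv_oc mu f ab) [RHS](lE _ _ ab).
by congr EFin; have := LR a; have := LR b; lra.
Qed.
End left_right_measures.

Theorem theorem6p8 (R : realType) (X : topologicalType)
    (X_locally_compact : locally_compact [set: X])
    (X_hausdorff : hausdorff_space X)
    (X_connected : connected [set: X])
    (mu : finite_deficient_topological_measure X R)
    (f : continuousType X R) (f_bounded : bounded_fun f) :
  (forall A : set R, measurable A -> right_measure mu f A = left_measure mu f A)
  <-> {ae @lebesgue_measure R, forall t : R,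
        (L1 mu f t + R1 mu f t)%:E = mu [set: X]}.
Proof.
have muX := fineK (finite_dtm_fin_num mu (@openT X)).
have aeF := ae_filter_ringOfSetsType (@lebesgue_measure R).
have aeL := ae_L1_right_limE mu f.
apply: (iff_trans (right_left_measure_eqP mu f f_bounded)); split => [LR|LR].
  by apply: (@filterS _ _ aeF) aeL => t LE; rewrite -LE LR muX.
apply: right_continuous_ae_cst.
  move=> t; apply: cvgD; first exact: L1_right_lim_right_continuous.
  have -> : R1 mu f = (fun u => - opp_R1 mu f u).
    by apply/funext => u; rewrite opprK.
  by apply: cvgN; exact: opp_R1_right_continuous.
by apply: (@filterS2 _ _ aeF) aeL LR => t -> /(congr1 fine).
Qed.
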